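(* Let $p$ be an odd prime and let $r$ be an integer with $1\le r<p$. Let $x,c$ be indeterminates over $\mathbb{Q}_p$, and let $c_1,\dots,c_r$ (in a splitting field over $\mathbb{Q}_p(x)$) satisfy $x(c-1)^r+c^{r-1}=x\prod_{i=1}^r(c-c_i)$. Then $$\sum_{0<k<p}\binom{rk}{k}\frac{x^k}{k}\equiv -r x^p\sum_{i=1}^r\pounds_1(c_i)\pmod p.$$
   Context: $\pounds_1(t)=\sum_{k=1}^{p-1}t^k/k$ is the truncated logarithm. Interpretation of the congruence: both sides are symmetric in $c_1,\dots,c_r$ and hence lie in $\mathbb{Q}_p(x)$; for $A,B\in\mathbb{Q}_p(x)$, $A\equiv B\pmod{p^n}$ means $A-B\in p^nR$, where $R$ is the valuation ring of $\mathbb{Q}_p(x)$ with respect to the $p$-adic (Gauss) valuation, i.e. the valuation extending $v_p$ with $v(\sum_j a_jx^j)=\min_j v_p(a_j)$ on polynomials. *)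

(* Defs.v *)
From HB Require Import structures.
From mathcomp Require Import all_boot all_order all_algebra all_field.
From mathcomp Require Import fraction boolp constructive_ereal.

Set Implicit Arguments.
Unset Strict Implicit.
Unset Printing Implicit Defensive.

Import Order.TTheory GRing.Theory Num.Theory.
Local Open Scope ring_scope.

(* Z_p as the inverse limit of the Z/p^n: [padic_res a n] is the representative
   of [a mod p^n] in {0, ..., p^n - 1}; the one equation states both this
   normalization and the compatibility of the residues.  The proof of [prime p]
   is a parameter of the type so that the domain structure can be attached. *)
Record padic_int (p : nat) (p_pr : prime p) := PadicInt {
  padic_res :> nat -> nat;
  padic_resP : forall n, padic_res n = (padic_res n.+1 %% p ^ n)%N
}.

(* Equality and choice on infinite residue sequences are classical. *)
HB.instance Definition _ p (p_pr : prime p) := gen_eqMixin (padic_int p_pr).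
HB.instance Definition _ p (p_pr : prime p) := gen_choiceMixin (padic_int p_pr).

Section PadicInt.
Variables (p : nat) (p_pr : prime p).
Local Notation Zp := (padic_int p_pr).
Implicit Types a b c : Zp.

Lemma padic_int_ext a b : a =1 b -> a = b.
Proof.
case: a b => [f fP] [g gP] /= /funext fg; rewrite -{}fg in gP *.
by congr PadicInt; exact: Prop_irrelevance.
Qed.

Lemma padic_res_mod a m n : (m <= n)%N -> (a n %% p ^ m)%N = a m.
Proof.
elim: n => [|n IHn]; first by rewrite leqn0 => /eqP ->; rewrite (padic_resP a 0) modn_mod.
rewrite leq_eqVlt => /predU1P[->|]; first by rewrite (padic_resP a n.+1) modn_mod.
by rewrite ltnS => mn; rewrite -IHn // [in RHS]padic_resP modn_dvdm // dvdn_exp2l.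
Qed.

Lemma padic_res_id a n : (a n %% p ^ n)%N = a n.
Proof. exact: padic_res_mod. Qed.

Lemma padic_of_subproof (f : nat -> nat) :
  (forall n, f n.+1 = f n %[mod p ^ n])%N ->
  forall n, (f n %% p ^ n)%N = ((f n.+1 %% p ^ n.+1) %% p ^ n)%N.
Proof. by move=> fP n; rewrite modn_dvdm ?dvdn_exp2l// fP. Qed.

Definition padic_of f fP : Zp := PadicInt p_pr (@padic_of_subproof f fP).

Lemma padic_cst_subproof k n : (k = k %[mod p ^ n])%N.
Proof. by []. Qed.

Lemma padic_add_subproof a b n :
  (a n.+1 + b n.+1 = a n + b n %[mod p ^ n])%N.
Proof. by rewrite -modnDm -!padic_resP. Qed.

Lemma padic_mul_subproof a b n :
  (a n.+1 * b n.+1 = a n * b n %[mod p ^ n])%N.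
Proof. by rewrite -modnMm -!padic_resP. Qed.

Lemma padic_res_lt a n : (a n < p ^ n)%N.
Proof. by rewrite -padic_res_id ltn_mod expn_gt0 prime_gt0. Qed.

Lemma padic_opp_subproof a n :
  (p ^ n.+1 - a n.+1 = p ^ n - a n %[mod p ^ n])%N.
Proof.
apply/eqP; rewrite -(eqn_modDr (a n.+1)) subnK; last exact/ltnW/padic_res_lt.
rewrite -(modnDmr _ (a n.+1)) -padic_resP subnK; last exact/ltnW/padic_res_lt.
by rewrite modnn expnS modnMl.
Qed.

Definition padic_zero : Zp := padic_of (padic_cst_subproof 0).
Definition padic_one : Zp := padic_of (padic_cst_subproof 1).
Definition padic_add a b : Zp := padic_of (padic_add_subproof a b).
Definition padic_mul a b : Zp := padic_of (padic_mul_subproof a b).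
Definition padic_opp a : Zp := padic_of (padic_opp_subproof a).

Lemma padic_addA : associative padic_add.
Proof. by move=> a b c; apply: padic_int_ext => n /=; rewrite modnDml modnDmr addnA. Qed.

Lemma padic_addC : commutative padic_add.
Proof. by move=> a b; apply: padic_int_ext => n /=; rewrite addnC. Qed.

Lemma padic_add0 : left_id padic_zero padic_add.
Proof. by move=> a; apply: padic_int_ext => n /=; rewrite modnDml add0n padic_res_id. Qed.

Lemma padic_addN : left_inverse padic_zero padic_opp padic_add.
Proof.
move=> a; apply: padic_int_ext => n /=.
by rewrite modnDml subnK ?modnn ?mod0n//; exact/ltnW/padic_res_lt.
Qed.

HB.instance Definition _ :=
  GRing.isZmodule.Build Zp padic_addA padic_addC padic_add0 padic_addN.

Lemma padic_mulA : associative padic_mul.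
Proof. by move=> a b c; apply: padic_int_ext => n /=; rewrite modnMml modnMmr mulnA. Qed.

Lemma padic_mulC : commutative padic_mul.
Proof. by move=> a b; apply: padic_int_ext => n /=; rewrite mulnC. Qed.

Lemma padic_mul1 : left_id padic_one padic_mul.
Proof. by move=> a; apply: padic_int_ext => n /=; rewrite modnMml mul1n padic_res_id. Qed.

Lemma padic_mulDl : left_distributive padic_mul +%R.
Proof.
by move=> a b c; apply: padic_int_ext => n /=; rewrite modnMml modnDm mulnDl.
Qed.

Lemma padic_one_neq0 : padic_one != 0.
Proof.
apply/eqP => /(congr1 (fun a : Zp => a 1%N)) /=.
by rewrite expn1 mod0n modn_small ?prime_gt1.
Qed.

HB.instance Definition _ := GRing.Zmodule_isComNzRing.Build Zp
  padic_mulA padic_mulC padic_mul1 padic_mulDl padic_one_neq0.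

Lemma padic_neq0 a : a != 0 -> exists n, a n.+1 != 0%N.
Proof.
move=> a0; apply: contrapT => /forallNP aE; case/eqP: a0.
apply: padic_int_ext => -[|n]; first by rewrite padic_resP expn0 modn1.
by have /negP := aE n; rewrite negbK => /eqP -> /=; rewrite mod0n.
Qed.

(* The normalized p-adic valuation of Z_p (v(p) = 1, v(0) = +oo): the largest n
   with a = 0 mod p^n, i.e. the least n with a <> 0 mod p^(n+1). *)
Definition padic_int_val a : \bar int :=
  if pselect (exists n, a n.+1 != 0%N) is left nz
  then ((ex_minn nz)%:Z)%:E else +oo%E.

Lemma padic_logn a n : a n.+1 != 0%N -> (forall m, (m < n)%N -> a m.+1 = 0%N) ->
  forall k, (n < k)%N -> a k != 0%N /\ logn p (a k) = n.
Proof.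
move=> an am k nk.
have ak : a k != 0%N by apply: contraNneq an => E; rewrite -(padic_res_mod a nk) E mod0n.
split=> //; apply/eqP; rewrite eqn_leq -ltnS; apply/andP; split.
  rewrite ltnNge -pfactor_dvdn ?lt0n//; apply: contra an => d.
  by rewrite -(padic_res_mod a nk) -/(dvdn _ _).
rewrite -pfactor_dvdn ?lt0n// /dvdn padic_res_mod ?(ltnW nk)//.
case: n am {an nk} => [_|n ->//]; by rewrite padic_resP expn0 modn1.
Qed.

Lemma padic_first a : a != 0 ->
  exists n, a n.+1 != 0%N /\ forall m, (m < n)%N -> a m.+1 = 0%N.
Proof.
move=> /padic_neq0 nz; case: (ex_minnP nz) => n an nmin; exists n; split=> // m mn.
by apply: contraTeq mn => /nmin; rewrite -leqNgt.
Qed.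

Lemma padic_mulf_eq0 a b : a * b = 0 -> (a == 0) || (b == 0).
Proof.
move=> ab; case: eqVneq => //= /padic_first[m [am am']].
case: eqVneq => // /padic_first[n [bn bn']].
have [|ak la] := @padic_logn a m am am' (m + n).+1; first by rewrite ltnS leq_addr.
have [|bk lb] := @padic_logn b n bn bn' (m + n).+1; first by rewrite ltnS leq_addl.
have := congr1 (fun c : Zp => c (m + n).+1) ab; rewrite /= mod0n => /eqP.
rewrite -/(dvdn _ _) pfactor_dvdn ?muln_gt0 ?lt0n ?ak ?bk//.
by rewrite lognM ?lt0n// la lb ltnn.
Qed.

Definition padic_unit : pred Zp := fun a => `[< exists b, b * a = 1 >].

Definition padic_inv a : Zp :=
  if pselect (exists b, b * a = 1) is left inv_a then projT1 (cid inv_a) else a.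

Lemma padic_mulVr : {in padic_unit, left_inverse 1 padic_inv *%R}.
Proof.
move=> a /asboolP ua; rewrite /padic_inv; case: pselect => // inv_a.
exact: projT2 (cid inv_a).
Qed.

Lemma padic_unitPl a b : b * a = 1 -> padic_unit a.
Proof. by move=> ba; apply/asboolP; exists b. Qed.

Lemma padic_inv_out : {in [predC padic_unit], padic_inv =1 id}.
Proof.
by move=> a /asboolP nua; rewrite /padic_inv; case: pselect => // ua; case: nua.
Qed.

HB.instance Definition _ := GRing.ComNzRing_hasMulInverse.Build Zp
  padic_mulVr padic_unitPl padic_inv_out.

HB.instance Definition _ :=
  GRing.ComUnitRing_isIntegral.Build Zp padic_mulf_eq0.

End PadicInt.

(* A valuation v on a domain extends uniquely to its fraction field by
   v(n/d) = v(n) - v(d); it does not depend on the fraction chosen when v is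
   multiplicative, and v(0) = +oo. *)
Definition frac_val (D : idomainType) (v : D -> \bar int) (A : {fraction D}) :
  \bar int := (v \n_(repr A) - v \d_(repr A))%E.

Notation padic p_pr := {fraction (padic_int p_pr)}.

Definition padic_val (p : nat) (p_pr : prime p) : padic p_pr -> \bar int :=
  frac_val (@padic_int_val p p_pr).

(* The minimum over the empty family, i.e. the value at 0, is +oo. *)
Definition gauss_val_poly (p : nat) (p_pr : prime p)
  (f : {poly padic p_pr}) : \bar int :=
  \big[Order.min/+oo%E]_(j < size f) padic_val f`_j.

Notation padic_ratfun p_pr := {fraction {poly padic p_pr}}.

Definition gauss_val (p : nat) (p_pr : prime p) : padic_ratfun p_pr -> \bar int :=
  frac_val (@gauss_val_poly p p_pr).

Definition gauss_ring (p : nat) (p_pr : prime p) : pred (padic_ratfun p_pr) :=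
  fun A => (0 <= gauss_val A)%E.
Arguments gauss_ring {p} p_pr.

Definition gauss_congr (p : nat) (p_pr : prime p) (n : nat)
  (A B : padic_ratfun p_pr) : Prop :=
  exists2 D, D \in gauss_ring p_pr & A - B = p%:R ^+ n * D.

(* The truncated logarithm of exponent p; its denominators 1, ..., p-1 are
   invertible in characteristic zero. *)
Definition truncated_log (p : nat) (F : fieldType) (t : F) : F :=
  \sum_(1 <= k < p) t ^+ k / k%:R.

Definition ratfun_X (p : nat) (p_pr : prime p) : padic_ratfun p_pr :=
  FracField.tofrac ('X : {poly padic p_pr}).

(* In {poly padic_ratfun p_pr}, 'X plays the role of the indeterminate c. *)
Definition xc_poly (p : nat) (p_pr : prime p) (r : nat) :
  {poly padic_ratfun p_pr} :=
  ratfun_X p_pr *: ('X - 1) ^+ r + 'X^(r.-1).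

(* Main.v *)
From HB Require Import structures.
Require Import Defs.
From mathcomp Require Import all_boot all_order all_algebra all_field.
From mathcomp Require Import fraction boolp constructive_ereal.
From mathcomp Require Import qpoly ring zify.

Set Implicit Arguments.
Unset Strict Implicit.
Unset Printing Implicit Defensive.

Import Order.TTheory GRing.Theory Num.Theory.
Local Open Scope ring_scope.

(** Put y = 1/x, so that the c_i are the roots of (c - 1)^r + y c^(r-1).
    Reversing this polynomial (lemma [recip_prod]) gives
      G(t) = (1 - t)^r + y t = prod_i (1 - c_i t),
    and the power sums of the c_i are the coefficients of -G'/G.  Since
    G = (1 - t)^r (1 + y t / (1 - t)^r), the geometric series for the second
    factor expands -G'/G into monomials in y and powers of 1/(1 - t), whose
    coefficients are binomial ([log_deriv_expansion], [power_sum_closed_form]):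
      (sum_i c_i^k) / k = r/k + sum_(1 <= j <= k) (-y)^j/j C(rj + k-j-1, k-j).
    Summing over 0 < k < p with the hockey-stick identity gives the exact value
    ([sum_truncated_log])
      sum_i L(c_i) = r H_(p-1) + sum_(0 < j < p) (-y)^j/j C(rj + p-1-j, p-1-j),
    where L is the truncated logarithm and H the harmonic number.

    Multiplied by -r x^p this is a polynomial in x, with coefficients in the
    localization of the integers at p, and it is the B of the theorem.  Its
    coefficient of x^p is divisible by p because H_(p-1) is, the terms k and
    p - k of H_(p-1) adding up to p/(k(p-k)); its coefficient of x^k for
    0 < k < p is r (-1)^k/(p-k) C(r(p-k) + k-1, k-1), and
    reflecting the upper index modulo p ([bin_reflect]) turns this into
    (r/k) C(rk-1, k-1) = C(rk, k)/k.  The identity [sum_binomial_congr] records the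
    explicit quotient of the difference by p.

    This quotient is the image of a polynomial over Z_p, because 2 and
    the k (p - k) are units there.  Such an image f lies in the valuation ring:
    whatever fraction n/d represents it, n = f d, and every coefficient of f d is
    a Z_p-combination of those of d, so its valuation is at least that of d
    ([gauss_ring_int_poly]). *)

(** * Truncated power series *)

Lemma sum_bin_diag m k :
  (\sum_(i < k.+1) 'C((m + i).-1, i) = 'C(m + k, k))%N.
Proof.
elim: k => [|k IHk]; first by rewrite big_ord_recr big_ord0 /= !bin0.
by rewrite big_ord_recr /= IHk !addnS /= binS addnC.
Qed.

(** The series 1/(1 - X), truncated at order n. *)
Definition geomX (R : nzRingType) n : {poly R} := \poly_(i < n) 1.

(** Multiplying by 1/(1 - X) takes partial sums of coefficients, so this is the
    hockey-stick identity again.  The predecessor on naturals is harmless: for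
    m = k = 0 it leaves C(0, 0) = 1. *)
Lemma coef_geomX_exp (R : nzRingType) n m k : (k < n)%N ->
  (geomX R n ^+ m)`_k = 'C((m + k).-1, k)%:R.
Proof.
elim: m k => [|m IHm] k kn.
  by rewrite expr0 coef1; case: k kn => [|k] //= _; rewrite bin_small.
rewrite exprS coefM /= -sum_bin_diag natr_sum (reindex_inj rev_ord_inj) /=.
apply: eq_bigr => i _; rewrite coef_poly.
have ik : (i <= k)%N by rewrite -ltnS.
rewrite subSS subKn// (leq_ltn_trans (leq_subr _ _) kn) mul1r IHm //.
exact: leq_ltn_trans kn.
Qed.

Lemma coef_in_qpolyXn (R : comNzRingType) n (f : {poly R}) k :
  (k < n)%N -> ((in_qpoly 'X^n f) : {poly R})`_k = f`_k.
Proof.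
move=> kn; rewrite /in_qpoly /= mk_monic_Xn prednK ?(leq_trans _ kn)//.
by rewrite -Pdiv.RingMonic.take_poly_rmodp coef_poly kn.
Qed.

Lemma in_qpolyXn_eq0 (R : comNzRingType) n : (0 < n)%N ->
  in_qpoly ('X^n : {poly R}) 'X^n = 0.
Proof.
move=> n0; apply/val_inj/polyP => k; rewrite coef0.
have [kn|nk] := ltnP k n; first by rewrite coef_in_qpolyXn// coefXn ltn_eqF.
rewrite nth_default// (leq_trans _ nk)// -ltnS.
by rewrite (leq_trans (size_mk_monic _))// mk_monic_Xn prednK // size_polyXn.
Qed.

(** * Power sums of the roots *)

Definition power_sum_poly (R : nzRingType) n (I : finType) (c : I -> R) : {poly R} :=
  \poly_(k < n) \sum_i c i ^+ k.+1.

(** Newton's identities in generating-function form, modulo X^n: the series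
    of the power sums is minus the logarithmic derivative of
    prod_i (1 - c_i X).  Logarithmic derivatives turn products into sums, so one
    factor suffices, for which the series is geometric. *)
Lemma power_sum_poly_log_deriv (R : comNzRingType) n (I : finType) (c : I -> R) :
  (0 < n)%N ->
  in_qpoly 'X^n (power_sum_poly n c * \prod_i (1 - c i *: 'X)
                 + (\prod_i (1 - c i *: 'X))^`()) = 0.
Proof.
move=> n0.
have -> : power_sum_poly n c = \sum_i \poly_(k < n) c i ^+ k.+1.
  apply/polyP => k; rewrite coef_poly coef_sum; case: ifP => kn.
    by apply: eq_bigr => i _; rewrite coef_poly kn.
  by rewrite big1 // => i _; rewrite coef_poly kn.
pose Q (q f : {poly R}) := in_qpoly 'X^n (q * f + f^`()) = 0.
apply: (big_ind2 Q) => [|q1 f1 q2 f2 H1 H2|i _]; rewrite /Q.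
- by rewrite mul0r add0r derivC rmorph0.
- rewrite derivM.
  have -> : (q1 + q2) * (f1 * f2) + (f1^`() * f2 + f1 * f2^`())
    = (q1 * f1 + f1^`()) * f2 + f1 * (q2 * f2 + f2^`()) by ring.
  by rewrite rmorphD !rmorphM /= H1 H2 mul0r mulr0 addr0.
have -> : \poly_(k < n) c i ^+ k.+1 = c i *: \sum_(k < n) (c i *: 'X) ^+ k.
  rewrite poly_def scaler_sumr; apply: eq_bigr => k _.
  by rewrite exprZn scalerA exprS.
rewrite derivB derivZ derivX (derivC 1) sub0r -scalerAl -[1 - _]opprB.
rewrite mulrN mulrC -subrX1 exprZn opprB scalerBr addrAC subrr sub0r scalerA.
by rewrite linearN linearZ /= in_qpolyXn_eq0 // scaler0 oppr0.
Qed.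

(** With t nilpotent, w = 1/(1 - t) and G = (1 - t)^r + y t, this expands
    q = -G'/G.  The factor G w^r = 1 + y t w^r is a unipotent perturbation of 1,
    inverted by a finite geometric series. *)
Lemma log_deriv_expansion (A : comNzRingType) (t w y q : A) n r : (0 < r)%N ->
  (1 - t) * w = 1 -> t ^+ n = 0 ->
  q * ((1 - t) ^+ r + y * t) = r%:R * (1 - t) ^+ r.-1 - y ->
  q = r%:R * w + \sum_(j < n) (- y) ^+ j.+1
       * (t ^+ j * (w ^+ (r * j.+1) + r%:R * (t * w ^+ (r * j.+1).+1))).
Proof.
case: r => // r _ tw tn /= E.
have twX k : (1 - t) ^+ k * w ^+ k = 1 by rewrite -exprMn tw expr1n.
(* [1 - s] is [G * w ^+ r], and [S] is its inverse. *)
pose s := - (y * t * w ^+ r.+1); pose S := \sum_(j < n) s ^+ j.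
have sS : (1 - s) * S = 1.
  have sn : s ^+ n = 0 by rewrite /s -!mulNr !exprMn tn mulr0 mul0r.
  by rewrite -[1 - s]opprB mulNr -subrX1 sn sub0r opprK.
have E1 : q * (1 - s) = r.+1%:R * w - y * w ^+ r.+1.
  have -> : 1 - s = ((1 - t) ^+ r.+1 + y * t) * w ^+ r.+1.
    by rewrite mulrDl twX opprK.
  rewrite mulrA E mulrBl; congr (_ - _).
  by rewrite (exprSr w) -mulrA [X in _ * X]mulrA twX mul1r.
have -> : \sum_(j < n) (- y) ^+ j.+1
   * (t ^+ j * (w ^+ (r.+1 * j.+1) + r.+1%:R * (t * w ^+ (r.+1 * j.+1).+1)))
   = - y * w ^+ r.+1 * (1 + r.+1%:R * t * w) * S.
  rewrite mulr_sumr; apply: eq_bigr => j _.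
  have -> : s ^+ j = (- y) ^+ j * (t ^+ j * w ^+ (r.+1 * j)).
    by rewrite /s -!mulNr !exprMn exprM mulrA.
  rewrite (exprSr (- y)) (exprS w (r.+1 * _)) mulnS exprD.
  move: (- y) (w ^+ (r.+1 * j)) (w ^+ r.+1) (r.+1%:R) (t ^+ j) => z v W R T.
  by move: (z ^+ j) => Z; ring.
have -> : q = q * (1 - s) * S by rewrite -mulrA sS mulr1.
rewrite E1; move: (r.+1%:R) => R.
have -> : R * w + - y * w ^+ r.+1 * (1 + R * t * w) * S =
  R * w * ((1 - s) * S) + - y * w ^+ r.+1 * (1 + R * t * w) * S.
  by rewrite sS mulr1.
by rewrite /s; move: (w ^+ r.+1) => W; ring.
Qed.

Lemma natr_inj_char0 (K : fieldType) : [pchar K] =i pred0 ->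
  injective (fun n : nat => n%:R : K).
Proof.
move=> char0 a b; wlog ab : a b / (a <= b)%N => [H|].
  by case/orP: (leq_total a b) => ab E; [|symmetry]; apply: H.
move=> /= /esym/eqP; rewrite -subr_eq0 -natrB // (pcharf0P K).1 // subn_eq0.
by move=> ba; apply/eqP; rewrite eqn_leq ab.
Qed.

(** Both sides are the reversals of polynomials that agree: at each z <> 0
    they equal z^r times the values at 1/z of the two sides of the hypothesis.  In
    characteristic zero the integers provide enough such z. *)
Lemma recip_prod (K : fieldType) (r : nat) (c : 'I_r -> K) (y : K) :
  (0 < r)%N -> [pchar K] =i pred0 ->
  \prod_(i < r) ('X - (c i)%:P) = ('X - 1) ^+ r + y *: 'X^(r.-1) ->
  \prod_i (1 - c i *: 'X) = (1 - 'X) ^+ r + y *: 'X.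
Proof.
move=> r0 char0 E; apply/eqP; rewrite -subr_eq0; set D := _ - _.
apply/eqP/(@roots_geq_poly_eq0 _ D [seq k.+1%:R | k <- iota 0 (size D)]).
- apply/allP => _ /mapP[k _ ->]; rewrite /root.
  have z0 : k.+1%:R != 0 :> K by rewrite (pcharf0P K).1.
  move: k.+1%:R z0 => z z0.
  rewrite /D !hornerE horner_prod subr_eq0; apply/eqP.
  have zV : z ^+ r * z^-1 ^+ r.-1 = z.
    by rewrite -[X in z ^+ X](prednK r0) exprS -mulrA -exprMn divff // expr1n mulr1.
  transitivity (z ^+ r * (\prod_(i < r) ('X - (c i)%:P)).[z^-1]).
    rewrite horner_prod -[X in z ^+ X]card_ord -prodr_const -big_split /=.
    by apply: eq_bigr => i _; rewrite !hornerE mulrBr divff // (mulrC z).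
  rewrite E !hornerE mulrDr -exprMn mulrBr mulr1 divff //; congr (_ + _).
  by rewrite mulrCA zV.
- rewrite map_inj_uniq ?iota_uniq // => a b.
  by move=> /(natr_inj_char0 char0) [].
- by rewrite size_map size_iota.
Qed.

(** The coefficient of X^k in the expansion of -G'/G. *)
Lemma power_sum_closed_form (K : comNzRingType) (r : nat) (c : 'I_r -> K) (y : K) k :
  (0 < r)%N -> \prod_i (1 - c i *: 'X) = (1 - 'X) ^+ r + y *: 'X ->
  \sum_i c i ^+ k.+1 = r%:R + \sum_(j < k.+1) (- y) ^+ j.+1 *
    ('C((r * j.+1 + (k - j)).-1, k - j)%:R
     + r%:R * ('X * geomX K k.+1 ^+ (r * j.+1).+1)`_(k - j)).
Proof.
move=> r0 cE; set n := k.+1.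
pose in_q : {rmorphism {poly K} -> {poly %/ 'X^n}} := in_qpoly ('X^n : {poly K}).
pose F := r%:R * geomX K n + \sum_(j < n) (- y%:P) ^+ j.+1
  * ('X^j * (geomX K n ^+ (r * j.+1) + r%:R * ('X * geomX K n ^+ (r * j.+1).+1))).
have qE : in_q (power_sum_poly n c) = in_q F.
  have tn : in_q 'X ^+ n = 0 by rewrite -rmorphXn; exact: in_qpolyXn_eq0.
  have tw : (1 - in_q 'X) * in_q (geomX K n) = 1.
    have -> : geomX K n = \sum_(i < n) 'X^i.
      by rewrite /geomX poly_def; apply: eq_bigr => i _; rewrite scale1r.
    rewrite -(rmorph1 in_q) -rmorphB -rmorphM /= -[1 - 'X]opprB mulNr -subrX1.
    by rewrite opprB rmorphB rmorphXn tn subr0.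
  rewrite (@log_deriv_expansion _ (in_q 'X) (in_q (geomX K n)) (in_q y%:P)
             (in_q (power_sum_poly n c)) n r r0 tw tn); last first.
    have qG : in_q (power_sum_poly n c * ((1 - 'X) ^+ r + y%:P * 'X))
              = in_q (r%:R * (1 - 'X) ^+ r.-1 - y%:P).
      apply/eqP; rewrite -subr_eq0 -rmorphB; apply/eqP.
      rewrite -[RHS](power_sum_poly_log_deriv c (isT : (0 < n)%N)).
      congr (in_q _); rewrite cE -mul_polyC derivD deriv_exp derivB derivX.
      rewrite (derivC 1) derivM derivX derivC mul0r add0r mulr1 add0r mulN1r.
      by rewrite mulNrn opprB [_ - r%:R * _]addrC mulr_natl.
    rewrite rmorphM rmorphD rmorphM rmorphXn !rmorphB rmorphM rmorphXn in qG.
    by rewrite rmorphB rmorph1 rmorph_nat in qG.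
  rewrite /F !(rmorphD, rmorphM, rmorph_nat, rmorph_sum) /=; congr (_ + _).
  apply: eq_bigr => j _.
  by rewrite !(rmorphD, rmorphM, rmorph_nat, rmorphXn, rmorphN).
have /(congr1 (fun f : {poly %/ 'X^n} => (f : {poly K})`_k)) := qE.
rewrite /= !coef_in_qpolyXn // coef_poly ltnSn => ->.
rewrite /F coefD -[r%:R]polyC_natr coefCM coef_poly ltnSn mulr1; congr (_ + _).
rewrite coef_sum; apply: eq_bigr => j _.
rewrite -polyCN -polyC_exp coefCM; congr (_ * _).
have jk : (j <= k)%N by rewrite -ltnS.
rewrite coefXnM ltnNge jk /= coefD coefCM coef_geomX_exp //.
by rewrite ltnS leq_subr.
Qed.

(** The bracket is the coefficient of X^m in (1 + r X w) w^(rj), where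
    w = 1/(1 - X).  As j X^(j-1) (1 + r X w) w^(rj) is the derivative of
    X^j w^(rj), it is (j + m)/j times the coefficient of X^m in w^(rj). *)
Lemma mul_log_coef (K : comNzRingType) n r j m : (0 < r)%N -> (0 < j)%N -> (m < n)%N ->
  j%:R * ('C((r * j + m).-1, m)%:R + r%:R * ('X * geomX K n ^+ (r * j).+1)`_m)
  = (j + m)%:R * 'C((r * j + m).-1, m)%:R.
Proof.
move=> r0 j0; case: m => [|m] mn.
  by rewrite coefXM /= mulr0 addr0 !addn0.
rewrite coefXM /= coef_geomX_exp ?(ltnW mn)// addnS /= mulrDr.
rewrite mulrA -natrM -!natrM -natrD mulnDl mulnC [(r * j)%N]mulnC; congr (_ + _)%:R.
have /= := mul_bin_left (j * r + m) m.
by rewrite addnK mulnC => <-.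
Qed.

(** The value of the sum of the truncated logarithms of the roots of
    (c - 1)^r + y c^(r-1), as a polynomial in y. *)
Definition power_sum_log (K : fieldType) (p r : nat) (y : K) : K :=
  r%:R * (\sum_(1 <= k < p) k%:R^-1)
  + \sum_(1 <= j < p) (- y) ^+ j / j%:R * 'C(r * j + (p - j.+1), p - j.+1)%:R.

Lemma fmorph_power_sum_log (K K' : fieldType) (phi : {rmorphism K -> K'})
    p r (y : K) :
  phi (power_sum_log p r y) = power_sum_log p r (phi y).
Proof.
rewrite /power_sum_log rmorphD rmorphM rmorph_nat !rmorph_sum /=.
congr (_ * _ + _); apply: eq_bigr => k _.
  by rewrite fmorphV rmorph_nat.
by rewrite !rmorphM fmorphV !rmorph_nat rmorphXn rmorphN.
Qed.

(** The sum over k of the closed forms of the (sum_i c_i^k)/k.  Exchanging the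
    two summations leaves, for each power of y, a diagonal sum of binomial
    coefficients. *)
Lemma sum_truncated_log (K : fieldType) p (r : nat) (c : 'I_r -> K) (y : K) :
  (0 < r)%N -> [pchar K] =i pred0 ->
  \prod_(i < r) ('X - (c i)%:P) = ('X - 1) ^+ r + y *: 'X^(r.-1) ->
  \sum_i truncated_log p (c i) = power_sum_log p r y.
Proof.
move=> r0 char0 /(recip_prod r0 char0) cE.
have nz k : k.+1%:R != 0 :> K by rewrite (pcharf0P K).1.
case: p => [|p].
  rewrite /power_sum_log !big_geq // mulr0 addr0 big1 // => i _.
  by rewrite /truncated_log big_geq.
transitivity (\sum_(0 <= k < p) (\sum_i c i ^+ k.+1) / k.+1%:R).
  rewrite /truncated_log exchange_big /= big_add1 /=.
  by apply: eq_bigr => k _; rewrite mulr_suml.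
rewrite /power_sum_log !big_add1 /= big_distrr /=.
transitivity (\sum_(0 <= k < p) (r%:R / k.+1%:R + \sum_(0 <= j < p | (j < k.+1)%N)
  (- y) ^+ j.+1 / j.+1%:R * 'C((r * j.+1 + (k - j)).-1, k - j)%:R)).
  apply: eq_big_nat => k /= kp.
  rewrite (power_sum_closed_form _ r0 cE) mulrDl mulr_suml; congr (_ + _).
  rewrite -(@big_nat_widen _ _ _ 0 k.+1 p xpredT) // [RHS]big_mkord.
  apply: eq_bigr => j _; rewrite -!mulrA; congr (_ * _).
  apply: (mulfI (nz j)); rewrite mulrA mul_log_coef // ?ltnS ?leq_subr //.
  rewrite addSn subnKC -1?ltnS // mulrAC divff // mul1r mulrA divff //.
  by rewrite mul1r.
rewrite big_split /=; congr (_ + _).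
rewrite (exchange_big_dep_nat xpredT) //=; apply: eq_big_nat => j /= jp.
rewrite -big_distrr /=; congr (_ * _).
rewrite -(@big_nat_widenl _ _ _ j 0%N p xpredT) // -natr_sum; congr _%:R.
rewrite -[X in (\sum_(X <= _ < _) _)%N]add0n big_addn subSS big_mkord.
rewrite -sum_bin_diag subnSK //; apply: eq_bigr => i _.
by rewrite addnK.
Qed.

(** * The p-adic and Gauss valuations *)

Lemma mul_denom_repr (D : idomainType) (y : {fraction D}) :
  y * FracField.tofrac \d_(repr y) = FracField.tofrac \n_(repr y).
Proof.
rewrite -[y in LHS](reprK y); unlock FracField.tofrac.
rewrite -[LHS]FracField.pi_mul; apply/eqmodP.
rewrite /= FracField.equivfE /FracField.mulf.
rewrite !numden_Ratio ?mulf_neq0 ?denom_ratioP ?oner_neq0 //.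
by rewrite reprK !mulr1 mulrC.
Qed.

Section GaussValuation.
Variables (p : nat) (p_pr : prime p).
Local Notation Zp := (padic_int p_pr).
Local Notation v := (@padic_int_val p p_pr).
Local Notation Qp := (padic p_pr).
Local Notation val := (@padic_val p p_pr).
Local Notation tofrac := (@FracField.tofrac _).

Lemma padic_int_val0 : v 0 = +oo%E.
Proof.
rewrite /padic_int_val; case: pselect => // nz; exfalso.
by case: nz => n /=; rewrite mod0n.
Qed.

Lemma padic_int_val_spec (a : Zp) : a != 0 -> exists n : nat,
  [/\ v a = (n%:Z)%:E, a n.+1 != 0%N & forall m, (m < n)%N -> a m.+1 = 0%N].
Proof.
move=> /padic_neq0 a0; rewrite /padic_int_val; case: pselect => // nz.
case: ex_minnP => n an nmin; exists n; split=> // m mn.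
by apply: contraTeq mn => /nmin; rewrite -leqNgt.
Qed.

Lemma padic_int_val_unique (a : Zp) n : a n.+1 != 0%N ->
  (forall m, (m < n)%N -> a m.+1 = 0%N) -> v a = (n%:Z)%:E.
Proof.
move=> an alt; have a0 : a != 0 by apply: contraNneq an => ->; rewrite /= mod0n.
have [k [-> ak akl]] := padic_int_val_spec a0.
congr (_%:E); congr Posz; case: (ltngtP k n) => // kn.
- by rewrite alt ?eqxx in ak.
- by rewrite akl ?eqxx in an.
Qed.

Lemma padic_int_valM (a b : Zp) : a != 0 -> b != 0 -> v (a * b) = (v a + v b)%E.
Proof.
move=> a0 b0.
have [m [-> am am']] := padic_int_val_spec a0.
have [n [-> bn bn']] := padic_int_val_spec b0.
(* Precision N suffices: [a N * b N] has valuation [m + n], less than N. *)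
set N := (m + n).+1.
have [aN la] : a N != 0%N /\ logn p (a N) = m by apply: padic_logn am am' _ _; lia.
have [bN lb] : b N != 0%N /\ logn p (b N) = n by apply: padic_logn bn bn' _ _; lia.
have abE i : (i.+1 <= N)%N -> ((a * b) i.+1 == 0%N) = (i < m + n)%N.
  move=> iN; rewrite -(padic_res_mod (a * b) iN) /= modn_dvdm ?dvdn_exp2l //.
  by rewrite -/(dvdn _ _) pfactor_dvdn ?muln_gt0 ?lt0n ?aN // lognM ?lt0n // la lb.
rewrite -EFinD -PoszD; apply: padic_int_val_unique; first by rewrite abE // ltnn.
by move=> i imn; apply/eqP; rewrite abE // ltnS ltnW.
Qed.

(** The ultrametric inequality v(a + b) >= min(v(a), v(b)), as an alternative. *)
Lemma padic_int_valD (a b : Zp) : (v a <= v (a + b)%R)%E \/ (v b <= v (a + b)%R)%E.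
Proof.
have [ab0|/padic_int_val_spec[k [-> abk _]]] := eqVneq (a + b) 0.
  by left; rewrite ab0 padic_int_val0 leey.
have small (c : Zp) : c k.+1 != 0%N -> (v c <= (k%:Z)%:E)%E.
  move=> ck; have c0 : c != 0 by apply: contraNneq ck => ->; rewrite /= mod0n.
  have [m [-> _ cm]] := padic_int_val_spec c0.
  rewrite lee_fin lez_nat leqNgt; apply: contra ck => km; by rewrite cm.
have [ak|ak] := eqVneq (a k.+1) 0%N; last by left; exact: small.
right; apply: small; apply: contraNneq abk => bk.
by rewrite /= ak bk mod0n.
Qed.

(** The valuation is defined through a chosen representative; any other
    fraction computes it.  The lower-bound form avoids subtracting an infinite
    value when y = 0. *)
Lemma padic_val_frac (y : Qp) (a b : Zp) (m : int) : b != 0 ->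
  y * tofrac b = tofrac a -> (m%:E <= val y)%E = (m%:E + v b <= v a)%E.
Proof.
move=> b0; have yE : y * tofrac \d_(repr y) = tofrac \n_(repr y).
  exact: mul_denom_repr.
move=> yb; rewrite /padic_val /frac_val; move: (repr y) yE => [[n d] /= d0] yE.
have E : n * b = a * d.
  by apply/eqP; rewrite -tofrac_eq !tofracM -yE -yb mulrAC.
have [n0|n0] := eqVneq n 0.
  have a0 : a = 0.
    by move/esym/eqP: E; rewrite n0 mul0r mulf_eq0 (negPf d0) orbF => /eqP.
  rewrite n0 a0 padic_int_val0 !leey.
  by have [k [-> _ _]] := padic_int_val_spec d0; rewrite leey.
have a0 : a != 0.
  by apply: contraNneq (mulf_neq0 n0 b0) => a0; rewrite E a0 mul0r.
have := padic_int_valM n0 b0; rewrite E padic_int_valM //.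
have [kn [-> _ _]] := padic_int_val_spec n0.
have [ka [-> _ _]] := padic_int_val_spec a0.
have [kb [-> _ _]] := padic_int_val_spec b0.
have [kd [-> _ _]] := padic_int_val_spec d0.
rewrite -!EFinD => -[] H; rewrite !lee_fin; apply/idP/idP; lia.
Qed.

Lemma padic_int_val_mulr (m : int) (a b d : Zp) : d != 0 -> b != 0 ->
  (m%:E + v b <= v a)%E -> (m%:E + v (b * d)%R <= v (a * d)%R)%E.
Proof.
move=> d0 b0; have [->|a0] := eqVneq a 0.
  by rewrite mul0r padic_int_val0 !leey.
rewrite !padic_int_valM //.
have [ka [-> _ _]] := padic_int_val_spec a0.
have [kb [-> _ _]] := padic_int_val_spec b0.
have [kd [-> _ _]] := padic_int_val_spec d0.
rewrite -!EFinD !lee_fin; lia.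
Qed.

Lemma padic_val0 : val 0 = +oo%E.
Proof.
have E (m : int) : (m%:E <= val 0%R)%E.
  rewrite (@padic_val_frac 0 0 1 m) ?oner_neq0 ?mul0r ?rmorph0 //.
  by rewrite padic_int_val0 leey.
case: (val 0) E => [k||] E //; last by have := E 0.
by have := E (k + 1); rewrite lee_fin; lia.
Qed.

Lemma padic_val_fin (y : Qp) : y != 0 -> val y \is a fin_num.
Proof.
move=> y0; rewrite /padic_val /frac_val.
have := mul_denom_repr y; case: (repr y) => [[n d] /= d0] yd.
have n0 : n != 0.
  by rewrite -(tofrac_eq0 n) -yd mulf_neq0 // tofrac_eq0.
have [kn [-> _ _]] := padic_int_val_spec n0.
by have [kd [-> _ _]] := padic_int_val_spec d0.
Qed.

Lemma padic_valD (m : int) (y z : Qp) :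
  (m%:E <= val y)%E -> (m%:E <= val z)%E -> (m%:E <= val (y + z)%R)%E.
Proof.
have := mul_denom_repr y; have := mul_denom_repr z.
move: (repr y) (repr z) => [[a b] /= b0] [[c d] /= d0] zE yE.
rewrite (padic_val_frac m b0 yE) (padic_val_frac m d0 zE) => ym zm.
rewrite (@padic_val_frac (y + z) (a * d + c * b) (b * d)) ?mulf_neq0 //.
  have ad := padic_int_val_mulr d0 b0 ym.
  have := padic_int_val_mulr b0 d0 zm; rewrite [d * b]mulrC => cb.
  by case: (padic_int_valD (a * d) (c * b)); apply: le_trans.
by rewrite rmorphD !rmorphM /= -yE -zE; ring.
Qed.

Lemma padic_val_mul_int (m : int) (a : Zp) (y : Qp) :
  (m%:E <= val y)%E -> (m%:E <= val (tofrac a * y)%R)%E.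
Proof.
have := mul_denom_repr y; move: (repr y) => [[n d] /= d0] yE.
rewrite (padic_val_frac m d0 yE) => ym.
rewrite (@padic_val_frac _ (a * n) d) //; last by rewrite -mulrA yE rmorphM.
apply: le_trans ym _.
have [->|n0] := eqVneq n 0; first by rewrite mulr0.
have [->|a0] := eqVneq a 0; first by rewrite mul0r padic_int_val0 leey.
rewrite padic_int_valM //.
have [ka [-> _ _]] := padic_int_val_spec a0.
have [kn [-> _ _]] := padic_int_val_spec n0.
by rewrite -EFinD lee_fin; lia.
Qed.

(** The minimum ranges over j < size f, but the other coefficients vanish and
    have valuation +oo. *)
Lemma gauss_val_poly_geP (m : int) (f : {poly Qp}) :
  reflect (forall j, (m%:E <= val f`_j)%E) (m%:E <= gauss_val_poly f)%E.
Proof.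
apply: (iffP idP) => [/bigmin_geP[_ H] j|H]; last first.
  by apply/bigmin_geP; split=> //; exact: leey.
have [jf|jf] := ltnP j (size f); first exact: (H (Ordinal jf)).
by rewrite nth_default // padic_val0 leey.
Qed.

Lemma gauss_val_poly_fin (f : {poly Qp}) : f != 0 -> gauss_val_poly f \is a fin_num.
Proof.
move=> f0; rewrite fin_numE; apply/andP; split.
  rewrite /gauss_val_poly; elim/big_ind: _ => // [x y x0 y0|i _].
    by rewrite minEle; case: ifP.
  have [->|fi0] := eqVneq f`_i 0; first by rewrite padic_val0.
  by have := padic_val_fin fi0; rewrite fin_numE => /andP[].
have f_lt : ((size f).-1 < size f)%N by rewrite prednK ?size_poly_gt0.
have := padic_val_fin (etrans (congr1 negb (lead_coef_eq0 f)) f0).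
rewrite fin_numE => /andP[_]; apply: contraNneq => foo.
rewrite -leye_eq -foo; exact: (bigmin_le _ (Ordinal f_lt)).
Qed.

Lemma gauss_val_poly_mul_int (g : {poly Zp}) (f : {poly Qp}) :
  f != 0 ->
  (gauss_val_poly f <= gauss_val_poly (map_poly tofrac g * f)%R)%E.
Proof.
move=> f0; have /fineK <- := gauss_val_poly_fin f0.
set m := fine _; have /gauss_val_poly_geP mf : (m%:E <= gauss_val_poly f)%E.
  by rewrite fineK ?gauss_val_poly_fin.
apply/gauss_val_poly_geP => j; rewrite coefM.
elim/big_ind: _ => [|y z|i _]; [by rewrite padic_val0 leey|exact: padic_valD|].
by rewrite coef_map; exact: padic_val_mul_int.
Qed.

(** The representative n/d of this element need not have denominator 1, but
    n is still the integral polynomial times d. *)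
Lemma gauss_ring_int_poly (g : {poly Zp}) :
  tofrac (map_poly tofrac g) \in gauss_ring p_pr.
Proof.
rewrite unfold_in /gauss_ring /gauss_val /frac_val.
have := mul_denom_repr (tofrac (map_poly tofrac g : {poly Qp})).
case: (repr _) => [[n d] /= d0]; rewrite -tofracM => /eqP.
rewrite tofrac_eq => /eqP <-.
by rewrite sube_ge0 ?(gauss_val_poly_fin d0) ?orbT //; exact: gauss_val_poly_mul_int.
Qed.

End GaussValuation.

(** * The congruence between binomial coefficients *)

Lemma natr_ffact (R : nzRingType) n m : (m <= n)%N ->
  (n ^_ m)%:R = \prod_(i < m) (n%:R - i%:R) :> R.
Proof.
move=> mn; rewrite ffact_prod natr_prod; apply: eq_bigr => i _.
by rewrite natrB // (leq_trans (ltnW (ltn_ord i))).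
Qed.

(** Multiplied by m!, which is invertible modulo p, both sides become products
    of m factors; as a - i = -(b - (m-1-i)) modulo p, they are opposite
    factor by factor, in reverse order. *)
Lemma bin_reflect (R : fieldType) p a b m : p \in [pchar R] -> (m < p)%N ->
  (m <= a)%N -> (m <= b)%N -> (a + b).+1%:R = m%:R :> R ->
  'C(a, m)%:R = (-1) ^+ m * 'C(b, m)%:R :> R.
Proof.
move=> pR mp ma mb abm; have p_pr := pcharf_prime pR.
have m0 : m`!%:R != 0 :> R.
  elim: {ma mb abm} m mp => [|m IHm] mp; first by rewrite oner_neq0.
  by rewrite factS natrM mulf_neq0 ?IHm ?(ltnW mp) // -(dvdn_pcharf pR) gtnNdvd.
apply: (mulIf m0); rewrite -mulrA -!natrM !bin_ffact !natr_ffact //.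
rewrite [in RHS](reindex_inj rev_ord_inj) /= -[X in (-1) ^+ X]card_ord.
rewrite -prodrN /=; apply: eq_bigr => i _.
apply/eqP; rewrite opprB natrB // -subr_eq0.
have -> : a%:R - i%:R - (m%:R - i.+1%:R - b%:R) = (a + b).+1%:R - m%:R :> R.
  rewrite -!natr1 natrD; ring.
by rewrite abm subrr.
Qed.

(** Up to the factor r, the coefficients of x^k in the two sides of the
    congruence are C(rk-1, k-1)/k and (-1)^k C(r(p-k) + k-1, k-1)/(p-k); this is
    their difference cleared of denominators, an integer. *)
Definition bin_defect (p r k : nat) : int :=
  ((p - k) * 'C((r * k).-1, k.-1))%:Z
  - (-1) ^+ k * (k * 'C(r * (p - k) + k.-1, k.-1))%:Z.

Lemma dvd_bin_defect p r k : prime p -> (0 < r)%N -> (0 < k < p)%N ->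
  (p %| bin_defect p r k)%Z.
Proof.
move=> p_pr r0 /andP[k0 kp].
have pF : p \in [pchar 'F_p] by rewrite pchar_Fp.
have p0 : p%:R = 0 :> 'F_p by apply: pcharf0.
rewrite (dvdz_pcharf pF) /bin_defect intrB intrM rmorphXn rmorphN1 /=.
rewrite -!pmulrn !natrM natrB 1?ltnW // p0 sub0r.
rewrite (@bin_reflect _ p (r * (p - k) + k.-1) (r * k).-1 k.-1 pF).
- have sgn : (-1) ^+ k * (-1) ^+ k.-1 = -1 :> 'F_p.
    by case: k k0 {kp} => // k _; rewrite exprS -mulrA -exprMn mulrNN mulr1 expr1n mulr1.
  rewrite mulrCA [in X in _ - _ * X]mulrA sgn; apply/eqP; ring.
- by rewrite prednK // ltnW.
- by rewrite leq_addl.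
- have : (k <= r * k)%N by rewrite leq_pmull.
  by lia.
- have -> : ((r * (p - k) + k.-1 + (r * k).-1).+1 = r * p + k.-1)%N by nia.
  by rewrite natrD natrM p0 mulr0 add0r.
Qed.

(** The quotient by p of the difference of the two sides of the congruence: the
    first term comes from p | H_(p-1), the second from p | [bin_defect]. It makes
    sense in any ring where the k < p are units, so that it can be formed both in
    the rational functions and in the polynomials over Z_p. *)
Definition congr_quotient (A : comUnitRingType) (p r : nat) (x : A) : A :=
  r%:R ^+ 2 * x ^+ p * (\sum_(1 <= k < p) (k * (p - k))%:R^-1) / 2%:R
  + \sum_(1 <= k < p)
      r%:R * x ^+ k * (bin_defect p r k %/ p)%Z%:~R / (k * (p - k))%:R.

Lemma rmorph_congr_quotient (A B : comUnitRingType) (phi : {rmorphism A -> B})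
    p r (x : A) :
  (forall k, (0 < k < p)%N -> (k%:R : A) \is a GRing.unit) -> (2 < p)%N ->
  phi (congr_quotient p r x) = congr_quotient p r (phi x).
Proof.
move=> natU p3.
have natMU k : (0 < k < p)%N -> ((k * (p - k))%:R : A) \is a GRing.unit.
  by move=> kp; rewrite natrM unitrM !natU //; lia.
rewrite /congr_quotient rmorphD /=; congr (_ + _).
  rewrite 3!rmorphM rmorphV ?natU //= !rmorphXn !rmorph_nat rmorph_sum /=.
  congr (_ * _ / _); apply: eq_big_nat => k kp.
  by rewrite rmorphV ?natMU //= rmorph_nat.
rewrite rmorph_sum /=; apply: eq_big_nat => k kp.
by rewrite 3!rmorphM (rmorphV phi) ?natMU //= rmorphXn !rmorph_nat rmorph_int.
Qed.

Lemma sum_binomial_congr (K : fieldType) p r (x : K) : [pchar K] =i pred0 ->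
  prime p -> odd p -> (0 < r)%N -> x != 0 ->
  \sum_(1 <= k < p) 'C(r * k, k)%:R * (x ^+ k / k%:R)
  + r%:R * x ^+ p * power_sum_log p r x^-1
  = p%:R * congr_quotient p r x.
Proof.
move=> char0 p_pr p_odd r0 x0.
have nz k : (0 < k)%N -> k%:R != 0 :> K by rewrite (pcharf0P K).1 // lt0n.
(* Twice the sum, with the terms k and p - k paired. *)
have H : \sum_(1 <= k < p) k%:R^-1
         = p%:R * (\sum_(1 <= k < p) (k * (p - k))%:R^-1) / 2%:R :> K.
  apply: (mulIf (nz 2%N isT)); rewrite mulfVK ?nz // mulr_natr mulr2n.
  rewrite {2}big_nat_rev -big_split big_distrr /=; apply: eq_big_nat => k /andP[k0 kp].
  have pk0 : (0 < p - k)%N by rewrite subn_gt0.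
  rewrite add1n subSS natrM invfM.
  have -> : p%:R = k%:R + (p - k)%:R :> K by rewrite -natrD subnKC // ltnW.
  by field; rewrite !nz.
rewrite /congr_quotient /power_sum_log H [in RHS]mulrDr mulrDr addrCA.
congr (_ + _); first by ring.
(* The term j of [power_sum_log] meets x^(p-j), hence the index k = p - j. *)
rewrite [X in _ + _ * X]big_nat_rev !big_distrr /= -big_split /=.
apply: eq_big_nat => k /andP[k0 kp].
have pk0 : (0 < p - k)%N by rewrite subn_gt0.
have -> : (1 + p - k.+1 = p - k)%N by rewrite add1n subSS.
have -> : (p - (p - k).+1 = k.-1)%N by lia.
have := divzK (dvd_bin_defect p_pr r0 (introT andP (conj k0 kp))).
move/(congr1 (fun z : int => z%:~R : K)); rewrite rmorphM /=.
set N := (_ %/ _)%Z%:~R => NE.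
have C1 : k%:R * 'C(r * k, k)%:R = k%:R * (r%:R * 'C((r * k).-1, k.-1)%:R) :> K.
  rewrite -!natrM -[in LHS](prednK k0) -mul_bin_diag (prednK k0); congr _%:R; nia.
rewrite (mulfI (nz _ k0) C1) exprNn.
have xE : x ^+ p * x^-1 ^+ (p - k) = x ^+ k.
  rewrite -{1}(subnK (ltnW kp)) exprD -mulrA mulrCA -exprMn divff // expr1n.
  by rewrite mulr1.
have sgn : (-1) ^+ (p - k) = - (-1) ^+ k :> K.
  rewrite -signr_odd oddB ?(ltnW kp) // p_odd -(signr_odd _ k).
  by case: (odd k) => /=; ring.
move: NE; rewrite /bin_defect intrB intrM rmorphXn rmorphN1 /= -!pmulrn !natrM sgn => NE.
transitivity (r%:R * x ^+ k * (N * p%:R) / (k%:R * (p - k)%:R)); last first.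
  by rewrite -natrM; ring.
rewrite NE -xE; set X := _ ^+ p; set Y := _ ^+ (p - k).
by field; rewrite !nz.
Qed.

(** * Integrality over Z_p *)

Section Integrality.
Variables (p : nat) (p_pr : prime p).
Local Notation Zp := (padic_int p_pr).

Lemma padic_res_nat k n : (k%:R : Zp) n = (k %% p ^ n)%N.
Proof.
elim: k => [|k IHk]; first by rewrite /= mod0n.
by rewrite -natr1 /= IHk modnDm addn1.
Qed.

Lemma padic_int_pchar0 : [pchar Zp] =i pred0.
Proof.
apply/pcharf0P => k; apply/eqP/eqP => [k0|->//].
have := padic_res_nat k k; rewrite k0 /= mod0n.
by rewrite modn_small // ltn_expl // prime_gt1.
Qed.

(** The inverses of k modulo the p^n, given by the extended Euclidean algorithm,
    are compatible because they are unique. *)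
Lemma padic_nat_unit k : (0 < k < p)%N -> (k%:R : Zp) \is a GRing.unit.
Proof.
move=> /andP[k0 kp].
have cop n : coprime (p ^ n) k by rewrite coprimeXl // prime_coprime // gtnNdvd.
pose f n := (egcdn k (p ^ n)).1.
have fP n : (f n * k = 1 %[mod p ^ n])%N.
  rewrite /f; case: egcdnP => // km kn -> _.
  by rewrite gcdnC (eqP (cop n)) modnMDl.
have f_comp n : (f n.+1 = f n %[mod p ^ n])%N.
  have fP1 : (f n.+1 * k = 1 %[mod p ^ n])%N.
    have pn := dvdn_exp2l p (leqnSn n).
    by rewrite -(modn_dvdm (_ * _) pn) fP modn_dvdm.
  rewrite -[f n.+1]muln1 -modnMmr -(fP n) modnMmr mulnCA.
  by rewrite -modnMmr fP1 modnMmr muln1.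
apply/unitrPr; exists (padic_of p_pr f_comp); apply: padic_int_ext => n /=.
by rewrite padic_res_nat modnMm mulnC fP.
Qed.

Definition int_poly_ratfun (g : {poly Zp}) : padic_ratfun p_pr :=
  FracField.tofrac (map_poly (@FracField.tofrac Zp) g).

Lemma int_poly_ratfun_additive : zmod_morphism int_poly_ratfun.
Proof. by move=> f g; rewrite /int_poly_ratfun !rmorphB. Qed.

Lemma int_poly_ratfun_multiplicative : monoid_morphism int_poly_ratfun.
Proof.
by split=> [|f g]; rewrite /int_poly_ratfun ?rmorph1 ?rmorphM.
Qed.

HB.instance Definition _ := GRing.isZmodMorphism.Build {poly Zp} (padic_ratfun p_pr)
  int_poly_ratfun int_poly_ratfun_additive.
HB.instance Definition _ := GRing.isMonoidMorphism.Build {poly Zp} (padic_ratfun p_pr)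
  int_poly_ratfun int_poly_ratfun_multiplicative.

Lemma ratfun_pchar0 : [pchar padic_ratfun p_pr] =i pred0.
Proof.
apply/pcharf0P => k; rewrite -(rmorph_nat int_poly_ratfun) tofrac_eq0.
rewrite rmorph_nat -polyC_natr polyC_eq0 -(rmorph_nat (@FracField.tofrac Zp)).
by rewrite tofrac_eq0; exact: (pcharf0P _).1 padic_int_pchar0 k.
Qed.

Lemma congr_quotient_gauss_ring r : odd p ->
  congr_quotient p r (ratfun_X p_pr) \in gauss_ring p_pr.
Proof.
move=> p_odd.
suff -> : congr_quotient p r (ratfun_X p_pr)
          = int_poly_ratfun (congr_quotient p r 'X) by exact: gauss_ring_int_poly.
have -> : ratfun_X p_pr = int_poly_ratfun 'X by rewrite /int_poly_ratfun map_polyX.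
rewrite -rmorph_congr_quotient ?odd_prime_gt2 //.
by move=> k /padic_nat_unit kU; rewrite -polyC_natr rmorph_unit.
Qed.
End Integrality.

Theorem theorem3 (p : nat) (p_pr : prime p) (p_odd : odd p)
    (r : nat) (r_gt0 : (0 < r)%N) (r_ltp : (r < p)%N)
    (L : fieldExtType (padic_ratfun p_pr))
    (xL : splittingFieldFor 1 (map_poly (in_alg L) (xc_poly p_pr r)) {:L})
    (c : 'I_r -> L)
    (cP : map_poly (in_alg L) (xc_poly p_pr r)
            = (ratfun_X p_pr)%:A *: \prod_(i < r) ('X - (c i)%:P)) :
  exists2 B : padic_ratfun p_pr,
    B%:A = - (r%:R * (ratfun_X p_pr)%:A ^+ p * \sum_(i < r) truncated_log p (c i)) &
    gauss_congr 1 (\sum_(1 <= k < p) 'C(r * k, k)%:R * (ratfun_X p_pr ^+ k / k%:R)) B.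
Proof.
have char0 := ratfun_pchar0 p_pr.
set x := ratfun_X p_pr in cP *.
pose A : {rmorphism padic_ratfun p_pr -> L} := in_alg L.
have x0 : x != 0 by rewrite tofrac_eq0 polyX_eq0.
have char0L : [pchar L] =i pred0.
  apply/pcharf0P => k; rewrite -(rmorph_nat A) fmorph_eq0; exact: (pcharf0P _).1.
have AxV : A x * A x^-1 = 1 by rewrite -rmorphM divff // rmorph1.
have cE : \prod_(i < r) ('X - (c i)%:P) = ('X - 1) ^+ r + (A x^-1) *: 'X^(r.-1).
  apply: (scalerI (_ : A x != 0)); first by rewrite fmorph_eq0.
  rewrite -cP /xc_poly rmorphD /= map_polyZ rmorphXn rmorphB /= map_polyX rmorph1.
  by rewrite map_polyXn scalerDr scalerA [X in _ = _ + X *: _]AxV scale1r.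
exists (- (r%:R * x ^+ p * power_sum_log p r x^-1)).
  rewrite (sum_truncated_log p r_gt0 char0L cE) -fmorph_power_sum_log.
  transitivity (A (- (r%:R * x ^+ p * power_sum_log p r x^-1))) => //.
  by rewrite rmorphN !rmorphM rmorphXn rmorph_nat.
exists (congr_quotient p r x); first exact: congr_quotient_gauss_ring.
by rewrite opprK expr1; exact: sum_binomial_congr.
Qed.
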